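(* Let $S$ be a finite nonempty set, $d\ge1$, $W=\mathbb Z^d$, $\Gamma=S^{\mathbb Z^d}$ with its Borel $\sigma$-algebra $\mathcal B$, and let $P(x,\cdot)$ be a transition probability kernel on $(\Gamma,\mathcal B)$ satisfying conditions (A1)–(A5) (listed in the context). If $\nu$ is a space-shift invariant Borel probability measure on $\Gamma$ with $I(\nu)<\infty$, then $\nu$ is time-invariant, i.e. $$\int_\Gamma P(x,A)\,\nu(dx)=\nu(A)\qquad\text{for every }A\in\mathcal B.$$
   Context: $\Gamma=S^W$ carries the product of the discrete topologies; $M(\Gamma)$ is the set of Borel probability measures on $\Gamma$. For $\Phi\subset\Psi\subset W$, $\pi_\Phi:S^\Psi\to S^\Phi$ is the natural projection (restriction), and for a site $z\in\Psi$, $\pi_z(u)=u(z)$. Conditions: (A1) For all $x\in\Gamma$, any finite $\Phi\subset W$ and each $v\in S^\Phi$, $P(x,\{y\in\Gamma:\pi_\Phi(y)=v\})=\prod_{z\in\Phi}P(x,\{y\in\Gamma:\pi_z(y)=\pi_z(v)\})$. (A2) For any $z\in W$ there exist a finite set $N(z)\subset W$ with $z\in N(z)$ and a local transition kernel $P_z:S^{N(z)}\times S\to[0,1]$ (i.e. $P_z(h,\cdot)$ is a probability distribution on $S$ for each $h\in S^{N(z)}$) such that $P(x,\{y\in\Gamma:\pi_z(y)=s\})=P_z(\pi_{N(z)}(x),s)$ for all $x\in\Gamma$, $s\in S$. (A3) $P_z(v,s)>0$ for all $z\in W$, $v\in S^{N(z)}$, $s\in S$. (A4) For any $z\in W$ the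 set $D(z)=\{z'\in W: z\in N(z')\}$ is finite. (A5) For all $x\in\Gamma$, $m\in\mathbb Z^d$, $A\in\mathcal B$: $P(x,A)=P(\theta_m(x),\theta_m(A))$, where $\theta_m:\Gamma\to\Gamma$ is the space shift $(\theta_m x)(z)=x(z+m)$, $z\in\mathbb Z^d$. A measure $\nu\in M(\Gamma)$ is space-shift invariant if $\nu(A)=\nu(\theta_m(A))$ for all $m\in\mathbb Z^d$, $A\in\mathcal B$. Donsker–Varadhan action functional: for $\nu\in M(\Gamma)$, $$I(\nu)=-\inf_{f}\int_\Gamma\log\left(\frac{\int_\Gamma f(y)P(x,dy)}{f(x)}\right)\nu(dx)\in[0,\infty],$$ where the infimum is over all positive continuous functions $f$ on $\Gamma$. *)

(* Defs.v *)
From HB Require Import structures.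
From mathcomp Require Import all_boot all_order all_algebra finmap.
From mathcomp Require Import all_classical all_reals all_analysis.

Set Implicit Arguments.
Unset Strict Implicit.
Unset Printing Implicit Defensive.

Import Order.TTheory GRing.Theory Num.Theory.
Import numFieldNormedType.Exports.

Local Open Scope classical_set_scope.
Local Open Scope ring_scope.

(* Finite nonempty sets. The chosen point is irrelevant: measurable types are
   pointed in the library, hence the need for one. *)
#[short(type="pointedFinType")]
HB.structure Definition PointedFinite := {T of Pointed T & Finite T}.

Notation site d := 'rV[int]_d.

Definition config (S : pointedFinType) (d : nat) : Type :=
  prod_topology (fun _ : site d => discrete_topology S).

Section configurations.
Context {S : pointedFinType} {d : nat}.

HB.instance Definition _ := Topological.copy (config S d)
  (prod_topology (fun _ : site d => discrete_topology S)).
HB.instance Definition _ := isPointed.Build (config S d) (fun=> point).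
HB.instance Definition _ :=
  Measurable.copy (config S d) (g_sigma_algebraType (@open (config S d))).

Definition proj_sites (Phi : {fset site d}) (x : config S d) : {ffun Phi -> S} :=
  [ffun z => x (val z)].

Definition space_shift (m : site d) (x : config S d) : config S d :=
  fun z => x (z + m).

End configurations.

Section conditions.
Context {R : realType} {S : pointedFinType} {d : nat}.

Definition distribution_on (p : S -> R) : Prop :=
  (forall s, 0 <= p s) /\ \sum_(s : S) p s = 1.

Definition independent_sites (P : R.-pker (config S d) ~> (config S d)) : Prop :=
  forall (x : config S d) (Phi : {fset site d}) (v : {ffun Phi -> S}),
    P x [set y | proj_sites Phi y = v] =
    (\prod_(z : Phi) P x [set y : config S d | y (val z) = v z])%E.

(* Values in [0, 1] follow from nonnegativity and total mass 1. *)
Definition local_transition (P : R.-pker (config S d) ~> (config S d))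
    (N : site d -> {fset site d})
    (Ploc : forall z : site d, {ffun N z -> S} -> S -> R) : Prop :=
  forall z : site d,
    [/\ z \in N z,
        forall h : {ffun N z -> S}, distribution_on (Ploc z h)
      & forall (x : config S d) (s : S),
          P x [set y : config S d | y z = s] =
          (Ploc z (proj_sites (N z) x) s)%:E].

Definition local_positivity (N : site d -> {fset site d})
    (Ploc : forall z : site d, {ffun N z -> S} -> S -> R) : Prop :=
  forall (z : site d) (v : {ffun N z -> S}) (s : S), 0 < Ploc z v s.

Definition finite_dependence (N : site d -> {fset site d}) : Prop :=
  forall z : site d, finite_set [set z' : site d | z \in N z'].

Definition shift_equivariant (P : R.-pker (config S d) ~> (config S d)) : Prop :=
  forall (x : config S d) (m : site d) (A : set (config S d)),
    measurable A -> P x A = P (space_shift m x) (space_shift m @` A).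

Definition shift_invariant (nu : probability (config S d) R) : Prop :=
  forall (m : site d) (A : set (config S d)),
    measurable A -> nu A = nu (space_shift m @` A).

Local Open Scope ereal_scope.

(* On the compact space config S d a positive continuous f is bounded and
   bounded away from 0, so the real-valued inner integral is the genuine one
   and the argument of ln is positive. *)
Definition action_functional (P : R.-pker (config S d) ~> (config S d))
    (nu : probability (config S d) R) : \bar R :=
  - ereal_inf
      [set \int[nu]_x (ln ((\int[P x]_y f y) / f x)%R)%:E
      | f in [set f : config S d -> R |
               continuous f /\ forall x, (0 < f x)%R]].

Definition time_invariant (P : R.-pker (config S d) ~> (config S d))
    (nu : probability (config S d) R) : Prop :=
  forall A : set (config S d), measurable A -> \int[nu]_x P x A = nu A.

End conditions.

(* Main.v *)
(* For a cylinder C and |t| < 1, the test function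
     f = prod_(j < n) (1 + t 1_(C_j)),
   with C_1, ..., C_n translates of C over disjoint sets of sites, satisfies
     P f (x) = prod_(j < n) (1 + t P(x, C_j))
   by independence. Shift invariance turns the integral of ln (P f / f) into n
   times the integral of ln (1 + t P(x, C)) - ln (1 + t 1_C(x)), and I(nu) < oo
   bounds it below uniformly in n, so the latter integral is nonnegative. Hence
   (t / (1 + t)) nu(C) <= t (nu P)(C), and t -> 0 from both sides gives
   nu(C) = (nu P)(C). *)
Require Import Defs.
From HB Require Import structures.
From mathcomp Require Import all_boot all_order all_algebra finmap.
From mathcomp Require Import all_classical all_reals all_analysis.
From mathcomp Require Import measurable_realfun ring lra zify.

Import Order.TTheory GRing.Theory Num.Theory.
Import numFieldNormedType.Exports.

Local Open Scope classical_set_scope.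
Local Open Scope ring_scope.

(** * Continuity of the test functions *)

Lemma continuous_indic_clopen (R : realType) (T : topologicalType) (A : set T) :
  clopen A -> continuous (\1_A : T -> R).
Proof.
move=> [oA cA] x; have [Ax|nAx] := pselect (A x).
  apply: cvg_near_cst; rewrite indicE mem_set//.
  by apply: filterS (open_nbhs_nbhs (conj oA Ax)) => y Ay; rewrite indicE mem_set.
apply: cvg_near_cst; rewrite indicE memNset//.
have : nbhs x (~` A) by apply: open_nbhs_nbhs; split=> //; exact: closed_openC.
by apply: filterS => y Ay; rewrite indicE memNset.
Qed.

Lemma continuous_affine_indic (R : realType) (T : topologicalType) (t : R) (A : set T) :
  clopen A -> continuous (fun x => 1 + t * \1_A x).
Proof.
move=> cA x; apply: cvgD; first exact: cvg_cst.
by apply: cvgM; [exact: cvg_cst|exact: continuous_indic_clopen].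
Qed.

Lemma continuous_prod (R : realType) (T : topologicalType) (I : Type) (r : seq I)
    (F : I -> T -> R) : (forall i, continuous (F i)) ->
  continuous (fun x => \prod_(i <- r) F i x).
Proof.
move=> cF; elim: r => [|i r IH] x.
  by under eq_fun do rewrite big_nil; exact: cvg_cst.
by under eq_fun do rewrite big_cons; apply: cvgM; [exact: cF|exact: IH].
Qed.

(** * Cylinder sets, the Borel sigma-algebra and the shifts *)

Section cylinders.
Context {S : pointedFinType} {d : nat}.
Implicit Types (Phi Psi : {fset site d}) (u v : site d -> S).

(** The pattern [u] is a total function of which only the values on [Phi] matter, so that supports
    can be united or translated without changing the type of the pattern. *)
Definition cylinder Phi u : set (config S d) :=
  [set y | forall z, z \in Phi -> y z = u z].

Lemma cylinder0 u : cylinder fset0 u = setT.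
Proof. by apply/seteqP; split=> // y _ z; rewrite inE. Qed.

Definition glue Phi u v : site d -> S := fun z => if z \in Phi then u z else v z.

Lemma cylinder_glue Phi Psi u v : [disjoint Phi & Psi]%fset ->
  cylinder (Phi `|` Psi)%fset (glue Phi u v) = cylinder Phi u `&` cylinder Psi v.
Proof.
move=> dis; apply/seteqP; split=> [y Hy|y [Hu Hv] z].
  split=> z zP; move: (Hy z); rewrite in_fsetU zP ?orbT /glue => /(_ isT)-> //.
    by rewrite zP.
  by rewrite ifN //; apply: contraTN zP => zP; exact: (fdisjointP dis).
rewrite in_fsetU /glue; case: ifPn => [zP _|_ /= zP]; first exact: Hu.
exact: Hv.
Qed.

(** Any point [w] of the intersection agrees with both patterns on their supports, so it serves as
    the pattern on the union. No disjointness is assumed, in contrast with gluing. *)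
Lemma cylinder_setI Phi Psi u v :
  cylinder Phi u `&` cylinder Psi v = set0 \/
  exists Theta w, cylinder Phi u `&` cylinder Psi v = cylinder Theta w.
Proof.
have [->|/set0P[w [wu wv]]] := eqVneq (cylinder Phi u `&` cylinder Psi v) set0.
  by left.
right; exists (Phi `|` Psi)%fset, w; apply/seteqP; split=> y.
  move=> [yu yv] z; rewrite in_fsetU => /orP[zP|zP].
    by rewrite yu// wu.
  by rewrite yv// wv.
by move=> yw; split=> z zP; rewrite yw ?in_fsetU ?zP ?orbT//; [exact: wu|exact: wv].
Qed.

Lemma site_clopen (z : site d) (s : S) : clopen [set y : config S d | y z = s].
Proof.
pose K := fun _ : site d => (discrete_topology S : topologicalType).
apply: (@preimage_clopen _ _ (@proj _ K z : config S d -> discrete_topology S)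
  [set s]); last exact: proj_continuous.
by split; [exact: discrete_open|exact: discrete_closed].
Qed.

Lemma cylinder_clopen Phi u : clopen (cylinder Phi u).
Proof.
suff -> : cylinder Phi u =
    \big[setI/setT]_(z <- Phi) [set y : config S d | y z = u z].
  by elim/big_ind: _; [exact: clopenT|exact: clopenI|move=> z _; exact: site_clopen].
rewrite -bigcap_seq; apply/seteqP; split=> y Hy z; exact: Hy.
Qed.

Lemma measurable_cylinder Phi u : measurable (cylinder Phi u).
Proof. by apply: sub_sigma_algebra; case: (cylinder_clopen Phi u). Qed.

(** The filter generated by the cylinders around [x] converges to [x]: in the product topology this
    is checked one coordinate at a time, and a condition at [z] follows from the cylinder on
    [[fset z]]. *)
Lemma nbhs_cylinder (x : config S d) (A : set (config S d)) :
  nbhs x A -> exists Phi, cylinder Phi x `<=` A.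
Proof.
pose F := filter_from [set: {fset site d}] (fun Phi => cylinder Phi x).
have FF : Filter F.
  apply: filter_from_filter; first by exists fset0.
  move=> Phi Psi _ _; exists (Phi `|` Psi)%fset => // y Hy.
  by split=> z zP; apply: Hy; rewrite in_fsetU zP ?orbT.
suff Fx : F --> x by move=> /Fx[Phi _ ?]; exists Phi.
apply/cvg_sup => z B [_ [[V oV <-] Vx] VB].
exists [fset z]%fset => // y Hy; apply: VB => /=.
by rewrite (Hy z) // inE.
Qed.

Definition cylinders : set (set (config S d)) :=
  [set A | A = set0 \/ exists Phi u, A = cylinder Phi u].

Lemma cylinders_setI : setI_closed cylinders.
Proof.
move=> A B [->|[Phi [u ->]]]; first by rewrite set0I; left.
move=> [->|[Psi [v ->]]]; first by rewrite setI0; left.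
have [->|[T [w ->]]] := cylinder_setI Phi Psi u v; first by left.
by right; exists T, w.
Qed.

(** There are countably many finite supports and finitely many patterns on each, so an open set is a
    countable union of the cylinders that it contains. *)
Lemma open_g_cylinders (U : set (config S d)) : open U -> <<s cylinders >> U.
Proof.
(* Patterns are recorded on their support only, which keeps [T] countable; [ext] extends them by
   [point], a value that the cylinder ignores. Codes that are invalid, or whose cylinder is not
   inside [U], contribute the empty set. *)
pose T : countType := {Phi : {fset site d} & {ffun Phi -> S}}.
pose ext (c : T) : site d -> S :=
  fun z => if insub z is Some z' then projT2 c z' else point.
pose C n := if @choice.unpickle T n is Some c then
  (if `[< cylinder (projT1 c) (ext c) `<=` U >] then
    cylinder (projT1 c) (ext c) else set0) else set0.
move=> oU; have -> : U = \bigcup_n C n.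
  apply/seteqP; split=> [x Ux|x [n _]]; last first.
    by rewrite /C; case: (choice.unpickle n) => [c|[]]; case: asboolP => [CU /CU//|_ []].
  have [Phi PhiU] := nbhs_cylinder x U (open_nbhs_nbhs (conj oU Ux)).
  pose c : T := existT _ Phi [ffun z => x (val z)].
  have extc z : z \in Phi -> ext c z = x z.
    by move=> zP; rewrite /ext insubT/= ffunE.
  exists (@choice.pickle T c) => //; rewrite /C (@choice.pickleK T) /=; case: asboolP => [_|].
    by move=> z /= /extc.
  by case=> y Hy; apply: PhiU => z zP; rewrite Hy// extc.
apply: (@bigcupT_measurable _ (g_sigma_algebraType cylinders)) => n.
rewrite /C; case: (choice.unpickle n) => [c|]; last exact: measurable0.
case: asboolP => _; last exact: measurable0.
by apply: sub_sigma_algebra; right; exists (projT1 c), (ext c).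
Qed.

Lemma measurable_g_cylinders :
  @measurable _ (config S d) = <<s cylinders >>.
Proof.
apply/seteqP; split.
  apply: smallest_sub; first exact: smallest_sigma_algebra.
  exact: open_g_cylinders.
apply: smallest_sub; first exact: sigma_algebra_measurable.
move=> A [->|[Phi [u ->]]]; first exact: measurable0.
exact: measurable_cylinder.
Qed.

Lemma preimage_space_shift_cylinder (m : site d) Phi u :
  space_shift m @^-1` cylinder Phi u =
  cylinder [fset (z + m)%R | z in Phi]%fset (fun z => u (z - m)).
Proof.
apply/seteqP; split=> y Hy z.
  by move=> /imfsetP[/= w wP ->]; rewrite addrK; exact: Hy.
by move=> zP; rewrite /space_shift Hy ?addrK//; apply/imfsetP; exists z.
Qed.

Lemma measurable_space_shift (m : site d) :
  measurable_fun [set: config S d] (space_shift m : config S d -> config S d).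
Proof.
apply: (@measurability _ _ _ _ _ _ cylinders); first exact: measurable_g_cylinders.
move=> _ [_ [->|[Phi [u ->]]] <-]; rewrite setTI; first by rewrite preimage_set0.
by rewrite preimage_space_shift_cylinder; exact: measurable_cylinder.
Qed.

Lemma measurable_preimage_shift (m : site d) (A : set (config S d)) :
  measurable A -> measurable (space_shift m @^-1` A).
Proof.
by move=> mA; rewrite -[X in measurable X]setTI; exact: measurable_space_shift.
Qed.

(** The shift by [- m] shows that the shift by [m] is onto. The invariance hypotheses speak of
    direct images; this converts them to preimages. *)
Lemma space_shift_image (m : site d) (A : set (config S d)) :
  space_shift m @` (space_shift m @^-1` A) = A.
Proof.
apply: image_preimage; rewrite -subTset => y _.
exists (space_shift (- m) y) => //.
by apply/funext => z; rewrite /space_shift addrK.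
Qed.

End cylinders.

(** * Integrals of products over disjoint blocks of sites *)

Section independent_blocks.
Context {R : realType} {S : pointedFinType} {d : nat}.
Variable P : R.-pker (config S d) ~> (config S d).
Hypothesis A1 : independent_sites P.
Implicit Types (Phi Psi : {fset site d}) (u v : site d -> S).

Definition transition (x : config S d) (A : set (config S d)) : R := fine (P x A).

Lemma transitionE x A : measurable A -> P x A = (transition x A)%:E.
Proof.
move=> mA; rewrite /transition fineK// ge0_fin_numE//.
by rewrite (@le_lt_trans _ _ 1%E) ?ltry// -(@prob_kernel _ _ _ _ _ P x) le_measure ?inE.
Qed.

Lemma transitionT x : transition x setT = 1.
Proof. by rewrite /transition (prob_kernel x : P x setT = 1%E). Qed.

Lemma transition_ge0 x A : 0 <= transition x A.
Proof. exact: fine_ge0. Qed.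

Lemma transition_le1 x A : measurable A -> transition x A <= 1.
Proof.
move=> mA; rewrite -lee_fin -transitionE// -(@prob_kernel _ _ _ _ _ P x).
by rewrite le_measure ?inE.
Qed.

Lemma measurable_transition A : measurable A ->
  measurable_fun setT (transition ^~ A).
Proof.
move=> mA.
exact: (measurableT_comp (fine_measurable measurableT) (measurable_kernel P A mA)).
Qed.

Lemma transition_cylinder x Phi u :
  transition x (cylinder Phi u) =
  \prod_(z <- Phi) transition x [set y | y z = u z].
Proof.
suff : P x (cylinder Phi u) = (\prod_(z <- Phi) transition x [set y | y z = u z])%:E.
  by rewrite /transition => ->.
have -> : cylinder Phi u =
    [set y | proj_sites Phi y = [ffun z : Phi => u (val z)]].
  apply/seteqP; split=> y /=.
    by move=> Hy; apply/ffunP => z; rewrite !ffunE Hy// fsvalP.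
  by move=> /ffunP Hy z zP; have := Hy [` zP]%fset; rewrite !ffunE.
rewrite A1 big_seq_fsetE /=.
elim/big_ind2: _ => //= [_ a _ b -> ->//|z _]; rewrite ffunE transitionE//.
by apply: sub_sigma_algebra; case: (site_clopen (val z) (u (val z))).
Qed.

Lemma transition_glue x Phi Psi u v : [disjoint Phi & Psi]%fset ->
  transition x (cylinder Phi u `&` cylinder Psi v) =
  transition x (cylinder Phi u) * transition x (cylinder Psi v).
Proof.
move=> dis; rewrite -cylinder_glue// !transition_cylinder.
(* Disjointness makes the concatenation duplicate-free, hence an enumeration of the union. *)
rewrite (perm_big (Phi ++ Psi)) /=; last first.
  apply: uniq_perm; rewrite ?fset_uniq// ?cat_uniq ?fset_uniq ?andbT//=.
    by apply/hasPn => z zPsi; apply: contraTN zPsi; exact: (fdisjointP dis).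
  by move=> z; rewrite in_fsetU mem_cat.
rewrite big_cat /=; congr (_ * _); apply: eq_big_seq => z zP; rewrite /glue.
  by rewrite zP.
by rewrite ifN//; apply: contraTN zP; exact: (fdisjointP dis).
Qed.

Notation block := ({fset site d} * (site d -> S))%type.

Definition tilt (t : R) (s : seq block) (y : config S d) : R :=
  \prod_(b <- s) (1 + t * \1_(cylinder b.1 b.2) y).

(** The additional factor [\1_(cylinder Phi u)] strengthens the induction: expanding the first
    factor of [tilt] leaves one term with the same cylinder and one with that block glued to it.
    Integrability is carried along because linearity of the integral requires it. *)
Lemma integral_tilt x (t : R) (s : seq block) :
  pairwise (fun b c : block => [disjoint b.1 & c.1]%fset) s ->
  forall Phi u, all (fun b : block => [disjoint Phi & b.1]%fset) s ->
  (P x).-integrable setT (EFin \o (\1_(cylinder Phi u) \* tilt t s)) /\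
  \int[P x]_y (\1_(cylinder Phi u) \* tilt t s) y =
  transition x (cylinder Phi u) *
    \prod_(b <- s) (1 + t * transition x (cylinder b.1 b.2)).
Proof.
elim: s => [_ Phi u _|[Psi v] s IH /= /andP[dPsi ds] Phi u /andP[dPhi dPhis]].
  have -> : \1_(cylinder Phi u) \* tilt t [::] = \1_(cylinder Phi u).
    by apply/funext => y; rewrite /tilt /= big_nil mulr1.
  have mC := measurable_cylinder Phi u.
  split.
    apply: measurable_bounded_integrable => //.
    - by rewrite prob_kernel ltry.
    - exists 1; split=> // M M1 y _ /=.
      by rewrite (le_trans _ (ltW M1))// indicE; case: (_ \in _); rewrite ?normr1 ?normr0.
  by rewrite big_nil mulr1 /Rintegral integral_indic// setIT.
have dU : all (fun b : block => [disjoint (Phi `|` Psi)%fset & b.1]%fset) s.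
  by apply/allP => b bs; rewrite fdisjointUX (allP dPhis)// (allP dPsi).
have [i1 e1] := IH ds Phi u dPhis.
have [i2 e2] := IH ds _ (glue Phi u v) dU.
pose f1 := \1_(cylinder Phi u) \* tilt t s.
pose f2 := \1_(cylinder (Phi `|` Psi)%fset (glue Phi u v)) \* tilt t s.
have E : \1_(cylinder Phi u) \* tilt t ((Psi, v) :: s) = f1 \+ t \*o f2.
  apply/funext => y; rewrite /f1 /f2 /tilt /= big_cons cylinder_glue// indicI /=.
  by ring.
have i3 : (P x).-integrable setT (EFin \o (t \*o f2)) 
    by exact: (integrableZl measurableT t i2).
split; first by rewrite E; exact: (integrableD measurableT i1 i3).
transitivity (\int[P x]_y (f1 \+ t \*o f2) y); first by rewrite -E.
rewrite [LHS](RintegralD measurableT i1 i3) [X in X + _]e1.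
rewrite [X in _ + X](RintegralZl t measurableT i2) [X in t * X]e2 big_cons.
rewrite cylinder_glue// transition_glue//=.
by ring.
Qed.

End independent_blocks.

(** * Separated translates, and the logarithm of the tilted ratio *)

Section shift_average.
Context {R : realType} {S : pointedFinType} {d : nat}.
Implicit Types (Phi : {fset site d}) (u : site d -> S).

Definition translate (m : site d) Phi u : {fset site d} * (site d -> S) :=
  ([fset (z + m)%R | z in Phi]%fset, fun z => u (z - m)).

Lemma cylinder_translate m Phi u :
  cylinder (translate m Phi u).1 (translate m Phi u).2 =
  space_shift m @^-1` cylinder Phi u.
Proof. by rewrite preimage_space_shift_cylinder. Qed.

(** It suffices to separate one coordinate, and [0 < d] provides one. The vector [e] precedes [u] in
    the quantifiers because supports do not depend on patterns. *)
Lemma separated_translates Phi : (0 < d)%N ->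
  exists e : site d, forall u (i j : nat), i != j ->
  [disjoint (translate (e *+ i) Phi u).1 & (translate (e *+ j) Phi u).1]%fset.
Proof.
move=> d0; pose o : 'I_d := Ordinal d0.
(* A crude common bound for the coordinate [o] on [Phi]. Two such coordinates differ by at most
   [2B], so steps of length [2B + 1] keep the translates apart. *)
pose B := (\sum_(z <- Phi) absz (z ord0 o))%N.
have leB z : z \in Phi -> (absz (z ord0 o) <= B)%N.
  by move=> zP; rewrite /B (big_fsetD1 z)//= leq_addr.
have far (a b : int) (i m : nat) : (absz a <= B)%N -> (absz b <= B)%N ->
    a + Posz B.*2.+1 *+ i <> b + Posz B.*2.+1 *+ (i + m.+1).
  move=> aB bB; rewrite mulrnDr mulrS.
  have : 0 <= Posz B.*2.+1 *+ m by exact: mulrn_wge0.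
  by move: (_ *+ m) (_ *+ i) => x y x0; lia.
exists (const_mx (Posz B.*2.+1)) => u i j ij; apply/fdisjointP => w.
move=> /imfsetP[/= z zP ->]; apply/imfsetP => -[/= z' zP' /matrixP/(_ ord0 o)].
rewrite !mxE !mulmxnE !mxE; move: ij; rewrite neq_ltn => /orP[] /subnKC <-.
  by rewrite addSnnS; apply: far; exact: leB.
by rewrite addSnnS => /esym; apply: far; exact: leB.
Qed.

Lemma ln_prod (I : Type) (r : seq I) (F : I -> R) : (forall i, 0 < F i) ->
  ln (\prod_(i <- r) F i) = \sum_(i <- r) ln (F i).
Proof.
move=> F0; elim: r => [|i r IH]; first by rewrite !big_nil ln1.
by rewrite !big_cons lnM ?IH// posrE ?prodr_gt0.
Qed.

(** The argument of [ln] stays above [1 - |t|], and [ln (1 + x) <= x] bounds it from above. Only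
    uniformity in [q] matters: it makes the integrands below bounded, hence integrable. *)
Lemma norm_ln1D_le (t q : R) : `|t| < 1 -> 0 <= q <= 1 ->
  `|ln (1 + t * q)| <= 1 - ln (1 - `|t|).
Proof.
move=> t1 /andP[q0 q1].
have tq : `|t * q| <= `|t| by rewrite normrM (ger0_norm q0) ler_piMr.
move: (tq); rewrite ler_norml => /andP[tq1 tq2].
have lo : ln (1 - `|t|) <= ln (1 + t * q).
  by rewrite ler_ln ?posrE; lra.
have up : ln (1 + t * q) <= t * q by apply: le_ln1Dx; lra.
have lt0 : ln (1 - `|t|) <= - `|t| by apply: le_ln1Dx; lra.
by rewrite ler_norml; have := normr_ge0 t; lra.
Qed.

Lemma tilt_gt0 (t : R) s (y : config S d) : `|t| < 1 -> 0 < tilt t s y.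
Proof.
move=> t1; apply: prodr_gt0 => b _; rewrite indicE; move: t1; rewrite ltr_norml.
by case: (_ \in _) => /andP[? ?]; rewrite /= ?mulr1 ?mulr0; lra.
Qed.

Lemma continuous_tilt (t : R) s : continuous (tilt t s : config S d -> R).
Proof.
apply: continuous_prod => b; apply: continuous_affine_indic.
exact: cylinder_clopen.
Qed.

Variables (P : R.-pker (config S d) ~> (config S d)) (nu : probability (config S d) R).
Hypotheses (A1 : independent_sites P) (A5 : shift_equivariant P).
Hypothesis nu_shift : shift_invariant nu.

Lemma transition_shift m x A : measurable A ->
  transition P (space_shift m x) A = transition P x (space_shift m @^-1` A).
Proof.
move=> mA; rewrite /transition (A5 x m) ?space_shift_image//.
exact: measurable_preimage_shift.
Qed.
Lemma bounded_integrable (g : config S d -> R) (M : R) :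
  measurable_fun setT g -> (forall x, `|g x| <= M) ->
  nu.-integrable setT (EFin \o g).
Proof.
move=> mg gM; apply: measurable_bounded_integrable => //.
  exact: (le_lt_trans (probability_le1 nu measurableT) (ltry 1)).
exists M; split; first exact: num_real.
by move=> N MN x _ /=; rewrite (le_trans (gM x))// ltW.
Qed.

(** Change of variables: the image of [nu] under the shift coincides with [nu] on measurable
    sets. *)
Lemma integral_shift (m : site d) (g : config S d -> R) (M : R) :
  measurable_fun setT g -> (forall x, `|g x| <= M) ->
  (\int[nu]_x (g (space_shift m x))%:E = \int[nu]_x (g x)%:E)%E.
Proof.
move=> mg gM.
have mgs := measurableT_comp mg (measurable_space_shift m).
have mE : measurable_fun setT (EFin \o g) by exact/measurable_EFinP.
have := @integral_pushforward _ _ _ _ R _ (measurable_space_shift m) nu setT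
  (EFin \o g) mE.
rewrite preimage_setT => /(_ _ measurableT) <-; last first.
  exact: (bounded_integrable _ _ mgs (fun x => gM _)).
apply: eq_measure_integral; first exact: measurable_space_shift.
move=> ms A mA _ /=.
rewrite /pushforward (nu_shift m) ?space_shift_image//.
exact: measurable_preimage_shift.
Qed.

(** The contribution of a single block to [ln (P f / f)]. *)
Definition tilt_log (t : R) A (x : config S d) : R :=
  ln (1 + t * transition P x A) - ln (1 + t * \1_A x).

Lemma indic_itv A (x : config S d) : 0 <= (\1_A x : R) <= 1.
Proof. by rewrite indicE; case: (_ \in _); rewrite /= ?lexx ?ler01. Qed.

Lemma transition_itv x A : measurable A -> 0 <= transition P x A <= 1.
Proof. by move=> mA; rewrite transition_ge0 transition_le1. Qed.

Lemma integrable_transition A : measurable A ->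
  nu.-integrable setT (EFin \o transition P ^~ A).
Proof.
move=> mA; apply: (bounded_integrable _ 1); first exact: measurable_transition.
by move=> x; have /andP[? ?] := transition_itv x _ mA; rewrite ger0_norm.
Qed.

Lemma tilt_log_bound t A x : `|t| < 1 -> measurable A ->
  `|tilt_log t A x| <= (1 - ln (1 - `|t|)) *+ 2.
Proof.
move=> t1 mA; rewrite (le_trans (ler_normB _ _))// mulr2n lerD//.
  exact/norm_ln1D_le/transition_itv.
exact/norm_ln1D_le/indic_itv.
Qed.

Lemma measurable_tilt_log t A : measurable A -> measurable_fun setT (tilt_log t A).
Proof.
move=> mA.
apply: measurable_funB; apply: (measurableT_comp (@measurable_ln R));
  apply: measurable_funD => //; apply: measurable_funM => //.
exact: measurable_transition.
Qed.

(** Independence factorises the numerator, equivariance moves each translation from the cylinder to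
    the point [x], and positivity of every factor allows the logarithm to be split. *)
Lemma ln_tilt_ratio (t : R) Phi u (e : site d) (n : nat) x : `|t| < 1 ->
  (forall u' (i j : nat), i != j ->
    [disjoint (translate (e *+ i) Phi u').1 & (translate (e *+ j) Phi u').1]%fset) ->
  let s := [seq translate (e *+ j) Phi u | j <- iota 0 n] in
  ln ((\int[P x]_y tilt t s y) / tilt t s x) =
  \sum_(j <- iota 0 n) tilt_log t (cylinder Phi u) (space_shift (e *+ j) x).
Proof.
move=> t1 sep s.
have ds : pairwise (fun b c : {fset site d} * (site d -> S) =>
    [disjoint b.1 & c.1]%fset) s.
  rewrite pairwise_map; have := iota_uniq 0 n; rewrite uniq_pairwise.
  by apply: sub_pairwise => i j; exact: sep.
have d0 : all (fun b : {fset site d} * (site d -> S) =>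
    [disjoint fset0 & b.1]%fset) s.
  by apply/allP => b _; exact: fdisjoint0X.
(* With empty support the cylinder is the whole space, and the extra indicator disappears. *)
have [_] := integral_tilt P A1 x t s ds fset0 u d0.
rewrite cylinder0 transitionT mul1r.
have -> : \1_setT \* tilt t s = tilt t s.
  by apply/funext => y /=; rewrite indicE in_setT mul1r.
move=> ->.
have pos q : 0 <= q <= 1 -> 0 < 1 + t * q.
  move=> /andP[q0 q1]; have : `|t * q| <= `|t| by rewrite normrM (ger0_norm q0) ler_piMr.
  by rewrite ler_norml => /andP[? ?]; lra.
have mC := measurable_cylinder Phi u.
have mCs j : measurable (space_shift (e *+ j) @^-1` cylinder Phi u).
  by rewrite -cylinder_translate; exact: measurable_cylinder.
have -> : \prod_(b <- s) (1 + t * transition P x (cylinder b.1 b.2)) =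
    \prod_(j <- iota 0 n) (1 + t * transition P (space_shift (e *+ j) x) (cylinder Phi u)).
  by rewrite big_map; apply: eq_bigr => j _; rewrite cylinder_translate transition_shift.
have -> : tilt t s x =
    \prod_(j <- iota 0 n) (1 + t * \1_(cylinder Phi u) (space_shift (e *+ j) x)).
  by rewrite /tilt big_map; apply: eq_bigr => j _; rewrite cylinder_translate.
rewrite ln_div ?posrE; last 2 first.
- by apply: prodr_gt0 => j _; apply: pos; exact: transition_itv.
- by apply: prodr_gt0 => j _; apply: pos; exact: indic_itv.
rewrite !ln_prod; last 2 first.
- by move=> j; apply: pos; exact: indic_itv.
- by move=> j; apply: pos; exact: transition_itv.
by rewrite -sumrB.
Qed.

(** * Finite action forces time invariance *)

Hypothesis d_gt0 : (0 < d)%N.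
Hypothesis I_fin : (action_functional P nu < +oo)%E.

Lemma action_lower_bound : exists c : R, forall f : config S d -> R,
  continuous f -> (forall x, 0 < f x) ->
  (c%:E <= \int[nu]_x (ln ((\int[P x]_y f y) / f x))%:E)%E.
Proof.
move: I_fin; rewrite /action_functional; set F := (X in ereal_inf X) => IF.
have [c cF] : exists c : R, (c%:E <= ereal_inf F)%E.
  (* Finite action excludes the infimum [-oo]; below [+oo] any constant will do. *)
  move: IF; case: (ereal_inf F) => [c _| _|//]; first by exists c.
  by exists 0; rewrite leey.
exists c => f cf f0; apply: (le_trans cF).
by apply: ereal_inf_lbound; exists f.
Qed.

Lemma integral_tilt_log_ge0 t Phi u : `|t| < 1 ->
  0 <= \int[nu]_x tilt_log t (cylinder Phi u) x.
Proof.
move=> t1; set C := cylinder Phi u; have mC : measurable C := measurable_cylinder _ _.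
have [e sep] := separated_translates Phi d_gt0.
have [c cP] := action_lower_bound.
set a := \int[nu]_x _.
have mL := measurable_tilt_log t _ mC.
have bL := (fun x => tilt_log_bound t C x t1 mC).
have iL := bounded_integrable _ _ mL bL.
(* The test function with [n] blocks yields [n] equal integrals, while [c] does not depend on [n]; a
   negative [a] is then impossible by the Archimedean property. *)
have ca n : c <= a *+ n.
  pose s := [seq translate (e *+ j) Phi u | j <- iota 0 n].
  have := cP _ (continuous_tilt t s) (fun x => tilt_gt0 t s x t1).
  under eq_integral do rewrite (ln_tilt_ratio _ _ _ _ _ _ t1 sep) -sumEFin.
  rewrite integral_sum//; last first.
    move=> j; apply: (bounded_integrable _ _ _ (fun x => bL (space_shift (e *+ j) x))).
    exact: (measurableT_comp mL (measurable_space_shift _)).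
  under eq_bigr do rewrite (integral_shift _ _ _ mL bL).
  rewrite -[X in (_ <= \sum_(_ <- _) X)%E -> _]fineK ?integrable_fin_num//.
  by rewrite sumEFin lee_fin big_const_seq count_predT size_iota iter_addr_0.
rewrite leNgt; apply/negP => a0.
have := archi_boundP (normr_ge0 (c / a)); set n := Num.bound _ => bn.
have := ca n; rewrite -mulr_natr => can.
have := le_lt_trans (ler_norm _) bn.
by rewrite ltr_ndivrMr// mulrC ltNge can.
Qed.

(** Both logarithms in [tilt_log] are replaced by linear bounds, pointwise, before integrating. The
    sign of [t] is left free, since both signs are used afterwards. *)
Lemma tilted_comparison t Phi u : `|t| < 1 ->
  t / (1 + t) * fine (nu (cylinder Phi u)) <=
  t * \int[nu]_x transition P x (cylinder Phi u).
Proof.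
move=> t1; set C := cylinder Phi u; have mC : measurable C := measurable_cylinder _ _.
have iT := integrable_transition _ mC.
have iI : nu.-integrable setT (EFin \o \1_C).
  apply: (bounded_integrable _ 1) => // x.
  by have /andP[? ?] := indic_itv C x; rewrite ger0_norm.
have iL := bounded_integrable _ _ (measurable_tilt_log t _ mC)
  (fun x => tilt_log_bound t C x t1 mC).
have := integral_tilt_log_ge0 t Phi u t1.
have i1 : nu.-integrable setT (EFin \o (t \*o (transition P ^~ C))).
  exact: (integrableZl measurableT t iT).
have i2 : nu.-integrable setT (EFin \o ((t / (1 + t)) \*o \1_C)).
  exact: (integrableZl measurableT (t / (1 + t)) iI).
suff le : \int[nu]_x tilt_log t C x <=
    \int[nu]_x (t * transition P x C - t / (1 + t) * \1_C x).
  move=> /le_trans/(_ le).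
  rewrite (RintegralB measurableT i1 i2) subr_ge0.
  rewrite [X in X <= _](RintegralZl _ measurableT iI).
  rewrite [X in _ <= X](RintegralZl _ measurableT iT).
  by rewrite [X in _ * X <= _]/Rintegral integral_indic// setIT.
apply: le_Rintegral => //; first exact: (integrableB measurableT i1 i2).
move=> x _; rewrite /tilt_log.
have /andP[q0 q1] := transition_itv x _ mC.
have tq : `|t * transition P x C| <= `|t| by rewrite normrM (ger0_norm q0) ler_piMr.
move: (t1) tq; rewrite ltr_norml ler_norml => /andP[? ?] /andP[? ?].
apply: lerB; first by apply: le_ln1Dx; lra.
rewrite indicE; case: (_ \in _) => /=; last by rewrite !mulr0 addr0 ln1.
rewrite !mulr1; have p0 : 0 < 1 + t by lra.
(* The lower bound [t / (1 + t) <= ln (1 + t)] is the upper bound [ln (1 + x) <= x] applied to the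
   inverse of [1 + t]. *)
have : ln (1 + (- (t / (1 + t)))) <= - (t / (1 + t)).
  apply: le_ln1Dx; rewrite ltrN2 ltr_pdivrMr//; lra.
have -> : 1 + - (t / (1 + t)) = (1 + t)^-1 by field; rewrite gt_eqF.
by rewrite lnV ?posrE// lerN2.
Qed.

Lemma time_invariant_cylinder Phi u :
  (\int[nu]_x P x (cylinder Phi u) = nu (cylinder Phi u))%E.
Proof.
set C := cylinder Phi u; have mC : measurable C := measurable_cylinder _ _.
under eq_integral do rewrite transitionE//.
have iT := integrable_transition _ mC.
rewrite -[LHS]fineK ?integrable_fin_num// -[RHS]fineK ?fin_num_measure//.
rewrite -/(\int[nu]_x transition P x C); congr EFin.
have q0 : 0 <= \int[nu]_x transition P x C.
  by apply: Rintegral_ge0 => x _; exact: transition_ge0.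
have cmp t := @tilted_comparison t Phi u.
rewrite -/C in cmp.
move: (\int[nu]_x _) (fine _) q0 cmp => q p q0 cmp.
(* The first bound is the comparison at [t], the second the comparison at [- t]. Both errors are put
   in the form [t * q], so one choice of [t] serves for both. *)
suff small t : 0 < t < 1 -> p <= q + t * q /\ q <= p + t * q.
  have smallP e : 0 < e -> exists2 t : R, 0 < t < 1 & t * q <= e.
    move=> e0; have q1 : 0 < q + 1 by rewrite ltr_wpDl.
    (* The half keeps [t] below 1; the denominator [q + 1] stays positive even if [q = 0]. *)
    exists (Num.min 2^-1 (e / (q + 1))).
      by rewrite lt_min gt_min divr_gt0// invr_gt0 invf_lt1 ?ltr1n ?ltr0n.
    have : Num.min 2^-1 (e / (q + 1)) * q <= e / (q + 1) * q.
      by rewrite ler_wpM2r// ge_min lexx orbT.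
    move/le_trans; apply; rewrite mulrAC ler_pdivrMr// ler_pM2l//.
    by rewrite lerDl.
  apply/eqP; rewrite eq_le; apply/andP; split; apply/ler_addgt0Pr => e e0.
    have [t /small[_ le_qp] tq] := smallP e e0.
    by rewrite (le_trans le_qp)// lerD2l.
  have [t /small[le_pq _] tq] := smallP e e0.
  by rewrite (le_trans le_pq)// lerD2l.
move=> /andP[t0 t1].
have tp : `|t| < 1 by rewrite gtr0_norm.
have tn : `|- t| < 1 by rewrite normrN.
have h1 := cmp _ tp; have h2 := cmp _ tn.
have p1 : 0 < 1 + t by lra.
have m1 : 0 < 1 - t by lra.
split.
  move: h1; rewrite mulrAC ler_pdivrMr// -mulrA ler_pM2l// => h1.
  by rewrite -[X in X + _]mul1r -mulrDl mulrC.
move: h2; rewrite mulrAC ler_pdivrMr// -mulrA !mulNr lerN2 ler_pM2l// => h2.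
by rewrite -lerBlDr -[X in X - _]mul1r -mulrBl mulrC.
Qed.

(** The sets satisfying the identity form a Dynkin system, and the cylinders with the empty set are
    a generating family closed under intersection. *)
Lemma action_time_invariant : time_invariant P nu.
Proof.
move=> A mA.
have PT x : P x setT = 1%E by exact: prob_kernel.
have PTfin x : (P x setT < +oo)%E by rewrite PT ltry.
have mP B : measurable B -> measurable_fun setT (P ^~ B).
  exact: measurable_kernel.
apply: (@dynkin_induction _ _ cylinders
  (fun A => \int[nu]_x P x A = nu A)%E); first exact: measurable_g_cylinders.
- exact: cylinders_setI.
- rewrite (eq_integral (cst 1%E)); last by move=> x _; exact: PT.
  by rewrite integral_cst// mul1e.
- move=> B [->|[Phi [u ->]]]; last exact: time_invariant_cylinder.
  by under eq_integral do rewrite measure0; rewrite integral0 measure0.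
- move=> B mB hB; rewrite probability_setC// -hB.
  under eq_integral => x _.
    rewrite (_ : P x (~` B) = 1 - P x B)%E; last first.
      rewrite -setTD measureD//; last exact: PTfin.
      by rewrite setTI; congr (_ - _)%E; exact: PT.
    over.
  rewrite integralB//.
  + rewrite integral_cst//; congr (_ - _)%E; rewrite -[RHS]mule1.
    by congr (_ * _)%E; exact: probability_setT.
  + exact: finite_measure_integrable_cst.
  + apply: eq_integrable (integrable_transition _ mB) => // x _.
    by rewrite /= transitionE.
(* Disjoint unions: countable additivity on both sides, with the nonnegative series integrated term
   by term. *)
- move=> F mF tF hF.
  have sumF (m : {measure set (config S d) -> \bar R}) :
      m (\bigcup_k F k) = (\sum_(0 <= n <oo) m (F n))%E.
    by rewrite measure_bigcup//; apply: eq_eseriesl => n; rewrite in_setT.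
  rewrite [RHS](sumF nu) (eq_integral _ _ (fun x _ => sumF (P x))).
  rewrite integral_nneseries//; last by move=> n; exact: mP.
  by apply: eq_eseriesr => n _; exact: hF.
- by rewrite -measurable_g_cylinders.
Qed.

End shift_average.

Theorem theorem2 (R : realType) (S : pointedFinType) (d : nat)
    (d_ge1 : (1 <= d)%N)
    (P : R.-pker (config S d) ~> (config S d))
    (N : site d -> {fset site d})
    (Ploc : forall z : site d, {ffun N z -> S} -> S -> R)
    (A1 : independent_sites P)
    (A2 : local_transition P Ploc)
    (A3 : local_positivity Ploc)
    (A4 : finite_dependence N)
    (A5 : shift_equivariant P)
    (nu : probability (config S d) R)
    (nu_shift : shift_invariant nu)
    (I_fin : (action_functional P nu < +oo)%E) :
  time_invariant P nu.
Proof. exact: action_time_invariant. Qed.
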